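(* Let $N=\{1,\dots,n\}$ index a training set of $n$ (i.i.d.) samples, let $U:2^N\to\mathbb{R}$ be a utility function with $U(\varnothing)=0$, where $U(S)$ is the performance on a test set of the model trained on the samples indexed by $S$, and fix a data point $i\in N$. For $k=0,\dots,n-1$ let $\sigma_{i,k}$ be the standard deviation of the marginal contribution $U(S\cup\{i\})-U(S)$ when $S$ is drawn uniformly at random from the subsets of $N\setminus\{i\}$ of size $k$, and assume $\sum_{j=0}^{n-1}\sigma_{i,j}>0$. Let $m>0$ be the total number of samples. Consider the stratified sampling estimator of the data Shapley $\phi_i$ that uses $m_{i,k}$ samples in stratum $k$, whose variance is $$V(m_{i,0},\dots,m_{i,n-1})=\frac{1}{n^2}\sum_{k=0}^{n-1}\frac{\sigma_{i,k}^2}{m_{i,k}} .$$ Then, among all (real, nonnegative) allocations with $\sum_{k=0}^{n-1}m_{i,k}=m$, the allocation minimizing the variance $V$ is $$m_{i,k}^*=m\,\frac{\sigma_{i,k}}{\sum_{j=0}^{n-1}\sigma_{i,j}},\qquad k=0,\dots,n-1 .$$ Moreover, the variance of the stratified sampling estimator with this allocation is no greater than the variance of the permutation sampling estimator of $\phi_i$ with the same total number $m$ of samples: $$V(m_{i,0}^*,\dots,m_{i,n-1}^* )\le \mathrm{Var}(\hat\phi_i^{\mathrm{perm}}).$$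
   Context: The data Shapley (Shapley value) of point $i$ is $$\phi_i=\frac1n\sum_{k=0}^{n-1}\phi_{i,k},\qquad \phi_{i,k}=\frac{1}{\binom{n-1}{k}}\sum_{S\subseteq N\setminus\{i\},\,|S|=k}\bigl(U(S\cup\{i\})-U(S)\bigr).$$ The training set is fixed, so $U$ is a deterministic set function and all randomness comes from the sampling algorithms. Stratified sampling: for each $k$, draw $m_{i,k}$ subsets independently and uniformly (with replacement) from stratum $k$, i.e. from $\{S\subseteq N\setminus\{i\}:|S|=k\}$, independently across strata; let $X_{i,k,j}$ be the marginal contribution $U(S\cup\{i\})-U(S)$ of $i$ to the $j$-th sampled subset $S$ of stratum $k$. The estimator is $\hat\phi_i=\frac1n\sum_{k=0}^{n-1}\hat\phi_{i,k}$ with $\hat\phi_{i,k}=\frac{1}{m_{i,k}}\sum_{j=1}^{m_{i,k}}X_{i,k,j}$. Its variance for positive integer sample sizes is the displayed $V$; allocations are treated as real numbers (integrality is ignored), and in $V$ a term with $\sigma_{i,k}=0$ is read as $0$ (even if $m_{i,k}=0$), while a term with $\sigma_{i,k}>0$ and $m_{i,k}=0$ is read as $+\infty$. Permutation sampling with $m$ samples ($m$ a positive integer): draw $m$ independent uniformly random permutations $O_1,\dots,O_m$ of $N$ and set $\hat\phi_i^{\mathrm{perm}}=\frac1m\sum_{t=1}^m\bigl(U(P_i^{O_t}\cup\{i\})-U(P_i^{O_t})\bigr)$, where $P_i^{O}$ is the set of elements preceding $i$ in the permutation $O$. *)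

(* Defs.v *)
From HB Require Import structures.
From mathcomp Require Import all_boot all_order all_algebra all_fingroup.
From mathcomp Require Import all_classical all_reals all_analysis.
Set Implicit Arguments.
Unset Strict Implicit.
Unset Printing Implicit Defensive.
Import Order.TTheory GRing.Theory Num.Theory.
Local Open Scope ring_scope.

(* The training set N = {1, ..., n} is 'I_n. *)

Section MarginalContributions.
Context {R : realType} {n : nat}.
Implicit Types (U : {set 'I_n} -> R) (i : 'I_n).

Definition marginal U i (S : {set 'I_n}) : R := U (i |: S)%SET - U S.

Definition stratum i (k : nat) : {set {set 'I_n}} :=
  [set S : {set 'I_n} | (S \subset [set~ i]) && (#|S| == k)]%SET.

End MarginalContributions.

(* Mean and variance of f under the uniform distribution on the nonempty finite
   set A; the variance is the population one, with divisor #|A|. *)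
Section UniformMoments.
Context {R : realType} {F : finType}.
Implicit Types (A : {set F}) (f : F -> R).

Definition umean A f : R := #|A|%:R^-1 * \sum_(x in A) f x.

Definition uvar A f : R := umean A (fun x => (f x - umean A f) ^+ 2).

End UniformMoments.

Section Allocations.
Context {R : realType} {n : nat}.
Implicit Types (U : {set 'I_n} -> R) (i : 'I_n) (m : R) (a : 'I_n -> R).

Definition sigma U i (k : 'I_n) : R :=
  Num.sqrt (uvar (stratum i k) (marginal U i)).

(* s ^ 2 / x for s, x >= 0, read as 0 when s = 0 and as +oo when x = 0 < s. *)
Definition var_term (s x : R) : \bar R :=
  if s == 0 then 0%E else if x == 0 then +oo%E else (s ^+ 2 / x)%:E.

Definition strat_variance U i a : \bar R :=
  ((n%:R ^- 2)%:E * \sum_(k < n) var_term (sigma U i k) (a k))%E.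

Definition is_allocation m a : Prop :=
  (forall k, 0 <= a k) /\ \sum_(k < n) a k = m.

Definition opt_allocation U i m : 'I_n -> R :=
  fun k => m * (sigma U i k / \sum_(j < n) sigma U i j).

End Allocations.

Section RandomSamples.
Context {R : realType} {d : measure_display} {T : measurableType d}.
Variable P : probability T R.

(* X is a random element of the discrete space F, uniform on A. *)
Definition uniform_on (F : finType) (A : {set F}) (X : T -> F) : Prop :=
  forall x : F, measurable (X @^-1` [set x])%classic /\
    P (X @^-1` [set x])%classic = (if x \in A then #|A|%:R^-1 else 0)%:E.

(* Mutual independence of a finite family of discrete random elements: the
   product rule for every subfamily J and all events. *)
Definition mutually_independent (I F : finType) (X : I -> T -> F) : Prop :=
  forall (J : {set I}) (B : I -> set F),
    P (\bigcap_(j in [set` J]) (X j @^-1` B j))%classic =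
    (\prod_(j in J) P (X j @^-1` B j)%classic)%E.

Context {n : nat}.
Implicit Types (U : {set 'I_n} -> R) (i : 'I_n).

(* The draw with index existT k j is the j-th sampled subset of stratum k, so
   independence is both within and across strata. *)
Definition stratified_draws i (c : 'I_n -> nat)
    (S : {k : 'I_n & 'I_(c k)} -> T -> {set 'I_n}) : Prop :=
  (forall kj : {k : 'I_n & 'I_(c k)},
     uniform_on (stratum i (tag kj)) (S kj)) /\
  mutually_independent S.

Definition strat_estimator U i (c : 'I_n -> nat)
    (S : {k : 'I_n & 'I_(c k)} -> T -> {set 'I_n}) : T -> R :=
  fun w => n%:R^-1 * \sum_(k < n) ((c k)%:R^-1 *
    \sum_(j < c k) marginal U i (S (Tagged (fun k : 'I_n => 'I_(c k)) j) w)).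

Definition permutation_draws (M : nat) (O : 'I_M -> T -> {perm 'I_n}) : Prop :=
  (forall t, uniform_on [set: {perm 'I_n}]%SET (O t)) /\
  mutually_independent O.

(* The permutation s lists N in the order s 0, s 1, ..., so the position of x
   is s^-1 x. *)
Definition predecessors i (s : {perm 'I_n}) : {set 'I_n} :=
  [set x : 'I_n | ((s^-1)%g x < (s^-1)%g i)%N]%SET.

Definition perm_estimator U i (M : nat) (O : 'I_M -> T -> {perm 'I_n}) :
    T -> R :=
  fun w => M%:R^-1 * \sum_(t < M) marginal U i (predecessors i (O t w)).

End RandomSamples.

(* Main.v *)
(* Completing the square writes each term [s ^ 2 / x] of the variance as an
   affine function of [s] and [x] plus a nonnegative gap that vanishes exactly
   when [x] is proportional to [s]; summed over an allocation, the affine part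
   is constant, which gives optimality and uniqueness.

   In a uniform permutation the position [k] of [i] is uniform and, given [k],
   the set of predecessors of [i] is uniform on stratum [k].  One permutation
   sample therefore has variance at least the average of the [sigma_k ^ 2],
   the variance within strata.  Divided by [m], this average is the stratified
   variance of the uniform allocation [m / n], so it dominates the optimum. *)
Require Import Defs.
From HB Require Import structures.
From mathcomp Require Import all_boot all_order all_algebra all_fingroup.
From mathcomp Require Import all_classical all_reals all_analysis.
From mathcomp Require Import ring.
Set Implicit Arguments.
Unset Strict Implicit.
Unset Printing Implicit Defensive.
Import Order.TTheory GRing.Theory Num.Theory.
Local Open Scope ring_scope.

(** * Mean and variance under the uniform distribution on a finite set *)

Section UniformMoments.
Context {R : realType} {F : finType}.
Implicit Types (A : {set F}) (f : F -> R).

Lemma umeanB A f :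
  umean A (fun x => f x - umean A f) = 0.
Proof.
set c := umean A f; rewrite /umean sumrB sumr_const mulrBr -/(umean A f) -/c.
rewrite -[c *+ _]mulr_natl mulrA.
have [A0|A0] := eqVneq #|A|%:R (0 : R); last by rewrite mulVf // mul1r subrr.
by rewrite /c /umean A0 invr0 !mul0r subrr.
Qed.

Lemma uvar_ge0 A f : 0 <= uvar A f.
Proof.
by rewrite mulr_ge0 ?invr_ge0 ?ler0n // sumr_ge0 // => x _; exact: sqr_ge0.
Qed.

Lemma uvarZ A c f :
  uvar A (fun x => c * f x) = c ^+ 2 * uvar A f.
Proof.
have umeanZ g b : umean A (fun x => b * g x) = b * umean A g.
  by rewrite /umean -mulr_sumr mulrCA.
rewrite /uvar -umeanZ umeanZ; congr umean.
by apply/funext => x; rewrite -mulrBr exprMn.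
Qed.

(** The mean minimises the mean squared deviation: replacing it by [c] adds the squared bias
    [(mu - c) ^+ 2]. The factor [#|A|%:R^-1 * #|A|%:R] is left unsimplified so that the identity
    also covers empty [A]. *)
Lemma uvar_le A f c :
  uvar A f <= umean A (fun x => (f x - c) ^+ 2).
Proof.
set mu := umean A f.
have -> : umean A (fun x => (f x - c) ^+ 2) =
    uvar A f + #|A|%:R^-1 * (#|A|%:R * (mu - c) ^+ 2).
  (* The inserted cross term is zero by [umeanB]; with it present, the identity holds summand by
     summand. *)
  transitivity (uvar A f + (mu - c) *+ 2 * umean A (fun x => f x - mu)
    + #|A|%:R^-1 * (#|A|%:R * (mu - c) ^+ 2)); last first.
    by rewrite umeanB mulr0 addr0.
  have -> : uvar A f = #|A|%:R^-1 * \sum_(x in A) (f x - mu) ^+ 2 by [].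
  rewrite /umean mulrCA -!mulrDr; congr (_ * _).
  rewrite mulr_sumr mulr_natl -sumr_const -!big_split /=.
  by apply: eq_bigr => x _; ring.
by rewrite lerDl mulr_ge0 ?invr_ge0 // mulr_ge0 ?sqr_ge0.
Qed.

End UniformMoments.

(** * Expectation and variance of finitely valued random elements *)

Section FiniteRandomElements.
Context {R : realType} {d : measure_display} {T : measurableType d}.
Local Open Scope classical_set_scope.
Variable P : probability T R.

(** Reduces integrability and integration of [g (X w)] to those of finitely many indicators, by
    linearity. *)
Lemma sum_indicE (F : finType) (X : T -> F) (g : F -> R) w :
  g (X w) = \sum_x g x * \1_(X @^-1` [set x]) w.
Proof.
rewrite (bigD1 (X w)) //= indicE mem_set // mulr1 big1 ?addr0 // => x neq_x.
by rewrite indicE memNset ?mulr0 // => /= wx; rewrite wx eqxx in neq_x.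
Qed.

Lemma integrable_finite (F : finType) (X : T -> F) (g : F -> R) :
  (forall x, measurable (X @^-1` [set x])) ->
  P.-integrable setT (fun w => (g (X w))%:E).
Proof.
move=> mX.
under [X in integrable _ _ X]eq_fun do rewrite sum_indicE -sumEFin.
apply: integrable_sum => // x _.
under [X in integrable _ _ X]eq_fun do rewrite EFinM.
exact/integrableZl/integrable_indic.
Qed.

Lemma integral_finite (F : finType) (X : T -> F) (g : F -> R) :
  (forall x, measurable (X @^-1` [set x])) ->
  (\int[P]_w (g (X w))%:E =
    \sum_x (g x)%:E * P (X @^-1` [set x]))%E.
Proof.
move=> mX; under eq_integral do rewrite sum_indicE -sumEFin.
rewrite integral_sum //; last first.
  move=> x; under [X in integrable _ _ X]eq_fun do rewrite EFinM.
  exact/integrableZl/integrable_indic.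
apply: eq_bigr => x _; under eq_integral do rewrite EFinM.
by rewrite integralZl ?integral_indic ?setIT //; exact: integrable_indic.
Qed.

Lemma integral_uniform (F : finType) (A : {set F}) (X : T -> F) (f : F -> R) :
  uniform_on P A X -> (\int[P]_w (f (X w))%:E = (umean A f)%:E)%E.
Proof.
move=> uX; rewrite integral_finite; last by move=> x; case: (uX x).
under eq_bigr => x _ do rewrite (proj2 (uX x)) -EFinM.
rewrite sumEFin /umean mulr_sumr big_mkcond [in RHS]big_mkcond.
by congr (_%:E); apply: eq_bigr => x _; case: ifP; rewrite ?mulr0 // mulrC.
Qed.

Section Independent.
Variables (I F : finType) (A : I -> {set F}) (X : I -> T -> F).
Hypothesis uX : forall i, uniform_on P (A i) (X i).
Hypothesis indX : mutually_independent P X.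

Let mX i x : measurable (X i @^-1` [set x]).
Proof. by case: (uX i x). Qed.

Let mXX i j xy : measurable ((fun w => (X i w, X j w)) @^-1` [set xy]).
Proof.
case: xy => x y.
rewrite (_ : _ @^-1` _ = X i @^-1` [set x] `&` X j @^-1` [set y]).
  exact: measurableI.
by apply/seteqP; split => w /= [-> ->].
Qed.

Lemma prob_pair i j x y : i != j ->
  P ((fun w => (X i w, X j w)) @^-1` [set (x, y)]) =
  (P (X i @^-1` [set x]) * P (X j @^-1` [set y]))%E.
Proof.
move=> neq_ij.
pose B k := if k == i then [set x] else [set y].
have -> : (fun w => (X i w, X j w)) @^-1` [set (x, y)] =
    \bigcap_(k in [set` [set i; j]%SET]) (X k @^-1` B k).
  apply/seteqP; split => w /=.
    case=> wx wy k /=; rewrite !inE /B => /orP[] /eqP->; rewrite ?eqxx //.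
    by rewrite eq_sym (negPf neq_ij).
  move=> Bw; congr pair.
    by have := Bw i; rewrite /B /= eqxx; apply; rewrite !inE eqxx.
  have := Bw j; rewrite /B /= eq_sym (negPf neq_ij); apply.
  by rewrite !inE eqxx orbT.
rewrite (indX [set i; j]%SET B) big_setU1 ?inE //= big_set1 /B eqxx.
by rewrite eq_sym (negPf neq_ij).
Qed.

(** The joint law of the pair is the product of its marginals by [prob_pair], so the finite double
    sum factors. *)
Lemma integral_pair i j (f g : F -> R) : i != j ->
  (\int[P]_w (f (X i w) * g (X j w))%:E =
   (umean (A i) f * umean (A j) g)%:E)%E.
Proof.
move=> neq_ij.
rewrite (integral_finite (fun xy => f xy.1 * g xy.2) (@mXX i j)) /=.
rewrite EFinM -(integral_uniform f (uX i)) -(integral_uniform g (uX j)).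
rewrite !integral_finite //.
(* Real-valued point masses allow the distributivity step to be carried out in [R]. *)
pose p k x := fine (P (X k @^-1` [set x])).
have Xfin k x : P (X k @^-1` [set x]) = (p k x)%:E.
  by rewrite fineK ?fin_num_measure.
rewrite [LHS](eq_bigr (fun xy => (f xy.1 * p i xy.1 * (g xy.2 * p j xy.2))%:E)).
  under [X in (X * _)%E]eq_bigr do rewrite Xfin -EFinM.
  under [X in (_ * X)%E]eq_bigr do rewrite Xfin -EFinM.
  by rewrite !sumEFin -EFinM big_distrlr pair_bigA.
by case=> x y _; rewrite /= prob_pair // !Xfin -!EFinM mulrACA.
Qed.

(** Bienaymé's identity: the square of the centred sum expands into a double sum, whose off-diagonal
    terms integrate to a product of means of centred functions, hence to zero. *)
Lemma variance_sum_independent (f : I -> F -> R) :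
  ('V_P[fun w => (\sum_i f i (X i w))%R] =
   (\sum_i uvar (A i) (f i))%:E)%E.
Proof.
pose c i := umean (A i) (f i).
pose g i x := f i x - c i.
have mean_sum : ('E_P[fun w => (\sum_i f i (X i w))%R] = (\sum_i c i)%:E)%E.
  rewrite unlock; under eq_integral do rewrite -sumEFin.
  rewrite integral_sum => [|//|i]; last exact: integrable_finite.
  rewrite -sumEFin; apply: eq_bigr => i _; exact: integral_uniform.
rewrite /variance unlock mean_sum unlock /=.
transitivity (\int[P]_w \sum_(ij : I * I)
    (g ij.1 (X ij.1 w) * g ij.2 (X ij.2 w))%:E)%E.
  apply: eq_integral => w _; rewrite sumEFin; congr _%:E.
  rewrite -(pair_bigA _ (fun i j => g i (X i w) * g j (X j w))) /=.
  by rewrite -big_distrlr /= sumrB.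
rewrite integral_sum => [|//|ij]; last first.
  exact: (integrable_finite (fun xy => g ij.1 xy.1 * g ij.2 xy.2)
    (@mXX ij.1 ij.2)).
rewrite -(pair_bigA _ (fun i j =>
  (\int[P]_w (g i (X i w) * g j (X j w))%:E)%E)) /=.
rewrite -sumEFin; apply: eq_bigr => i _.
rewrite (bigD1 i) //= big1 ?adde0 => [|j neq_ji].
  rewrite -(integral_uniform _ (uX i)).
  by apply: eq_integral => w _; rewrite -expr2.
by rewrite (integral_pair (g i) (g j)) 1?eq_sym // !umeanB mulr0.
Qed.

End Independent.
End FiniteRandomElements.

(** * Optimality and uniqueness of the proportional allocation *)

Section Allocation.
Context {R : realType}.
Implicit Types c s x : R.

(** At [x = 0] the conventions of [var_term] apply. The case [x = 0] is tested first because for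
    [s = 0] and [x > 0] the gap is [c ^+ 2 * x], not [0]. *)
Definition var_gap c s x : \bar R :=
  if x == 0 then (if s == 0 then 0%E else +oo%E)
  else ((s - c * x) ^+ 2 / x)%:E.

(* Completing the square: [s ^ 2 / x] lies above its tangent in [s] at
   [s = c x], and the gap between the two is a square over [x]. *)
Lemma var_termE c s x :
  var_term s x = ((c * s *+ 2 - c ^+ 2 * x)%:E + var_gap c s x)%E.
Proof.
rewrite /var_term /var_gap.
have [->|s0] := eqVneq s 0; have [->|x0] := eqVneq x 0 => //.
- by rewrite adde0 !mulr0 mul0rn subrr.
- by rewrite -EFinD; congr _%:E; field.
- by rewrite -EFinD; congr _%:E; field.
Qed.

Lemma var_gap_ge0 c s x : 0 <= x -> (0 <= var_gap c s x)%E.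
Proof.
move=> x_ge0; rewrite /var_gap; case: ifP => _; first by case: ifP.
by rewrite lee_fin divr_ge0 // sqr_ge0.
Qed.

Lemma var_gap_eq0 c s x : (var_gap c s x == 0) = (s == c * x).
Proof.
rewrite /var_gap; have [->|x0] := eqVneq x 0.
  by rewrite mulr0; case: (eqVneq s 0); rewrite ?eqxx.
by rewrite eqe mulf_eq0 invr_eq0 (negPf x0) orbF sqrf_eq0 subr_eq0.
Qed.

Context {n : nat}.
Variables (U : {set 'I_n} -> R) (i : 'I_n) (m : R).
Let sg := sigma U i.
(** The proportionality constant at the optimum: summing [sg k = c * a k] over an allocation of
    total [m] forces this value. *)
Let c := (\sum_j sg j) / m.
Hypotheses (sg_gt0 : 0 < \sum_j sg j) (m_gt0 : 0 < m).

Let c_gt0 : 0 < c. Proof. exact: divr_gt0. Qed.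

Lemma ordinal_size_gt0 : (0 < n)%N.
Proof. by case: n i => [[]|]. Qed.

Lemma opt_allocation_eq k x : (x == opt_allocation U i m k) = (sg k == c * x).
Proof.
have -> : opt_allocation U i m k = c^-1 * sg k.
  by rewrite /opt_allocation /c invf_div -mulrA [_^-1 * _]mulrC.
by rewrite eq_sym -(inj_eq (mulfI (lt0r_neq0 c_gt0))) mulVKf // gt_eqF.
Qed.

Lemma opt_allocationP : is_allocation m (opt_allocation U i m).
Proof.
split=> [k|].
  by rewrite mulr_ge0 ?divr_ge0 ?sqrtr_ge0 // ltW.
by rewrite -mulr_sumr -mulr_suml mulfV ?mulr1 // gt_eqF.
Qed.

(** By the choice of [c] the affine parts add up to [(\sum_j sg j) ^+ 2 / m], so the allocation
    enters only through the gaps. *)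
Lemma strat_varianceE (a : 'I_n -> R) : is_allocation m a ->
  (strat_variance U i a = (n%:R ^- 2)%:E *
    (((\sum_j sg j) ^+ 2 / m)%:E + \sum_(k < n) var_gap c (sg k) (a k)))%E.
Proof.
case=> a_ge0 sum_a; congr (_ * _)%E.
under eq_bigr do rewrite (var_termE c).
rewrite big_split sumEFin; congr (_%:E + _)%E.
rewrite sumrB -mulr_sumr sum_a sumrMnl -mulr_sumr /c.
by field; rewrite gt_eqF.
Qed.

Lemma strat_variance_opt : strat_variance U i (opt_allocation U i m) =
  ((n%:R ^- 2)%:E * ((\sum_j sg j) ^+ 2 / m)%:E)%E.
Proof.
rewrite strat_varianceE; last exact: opt_allocationP.
rewrite [X in (_ + X)%E]big1 ?adde0 // => k _.
by apply/eqP; rewrite var_gap_eq0 -opt_allocation_eq.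
Qed.

Lemma strat_variance_opt_le (a : 'I_n -> R) : is_allocation m a ->
  (strat_variance U i (opt_allocation U i m) <= strat_variance U i a)%E.
Proof.
move=> am; rewrite strat_variance_opt strat_varianceE //.
apply: lee_wpmul2l; first by rewrite lee_fin invr_ge0 exprn_ge0.
rewrite leeDl // sume_ge0 // => k _.
by apply: var_gap_ge0; case: am.
Qed.

(** Cancelling the finite constant leaves a sum of gaps that is at most zero; each gap is
    nonnegative, so each vanishes, which means proportionality. *)
Lemma strat_variance_opt_unique (a : 'I_n -> R) : is_allocation m a ->
  strat_variance U i a = strat_variance U i (opt_allocation U i m) ->
  a =1 opt_allocation U i m.
Proof.
move=> am; rewrite strat_variance_opt strat_varianceE //.
have n2_gt0 : 0 < n%:R ^- 2 :> R.
  by rewrite invr_gt0 exprn_gt0 // ltr0n ordinal_size_gt0.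
move=> /eqP; rewrite eq_le => /andP[+ _].
rewrite lee_pmul2l ?lte_fin // -[leRHS]adde0 leeD2lE // => gap_le0.
have gap_ge0 k : true -> (0 <= var_gap c (sg k) (a k))%E.
  by move=> _; apply: var_gap_ge0; case: am.
have /eqP : (\sum_(k < n) var_gap c (sg k) (a k) = 0)%E.
  by apply/eqP; rewrite eq_le gap_le0 sume_ge0.
rewrite seq_psume_eq0 // => /allP gap0 k.
apply/eqP; rewrite opt_allocation_eq -var_gap_eq0.
exact: (implyP (gap0 k (mem_index_enum k))).
Qed.

End Allocation.

(** * Counting permutations by the position and predecessors of [i] *)

Section RandomPermutation.
Context {n : nat}.
Variable i : 'I_n.
Implicit Types (S : {set 'I_n}) (s t : {perm 'I_n}) (k : 'I_n).

Lemma predecessors_imset s :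
  predecessors i s = [set s x | x in [set j : 'I_n | (j < s^-1%g i)%N]].
Proof.
apply/setP => x; rewrite inE -{2}[x](permKV s) mem_imset ?inE //.
exact: perm_inj.
Qed.

Lemma card_predecessors s : #|predecessors i s| = s^-1%g i.
Proof.
rewrite predecessors_imset card_imset; last exact: perm_inj.
by rewrite -sum1dep_card big_ord_narrow ?sum1_card ?card_ord // ltnW.
Qed.

Lemma predecessors_stratum s k :
  (predecessors i s \in stratum i k) = (s^-1%g i == k).
Proof.
rewrite inE card_predecessors (_ : _ \subset _ = true) //.
by apply/fintype.subsetP => x; rewrite !inE; apply: contraTneq => ->;
   rewrite ltnn.
Qed.

Lemma predecessors_mulg s t : t i = i ->
  predecessors i (s * t)%g = [set t x | x in predecessors i s].
Proof.
move=> ti; have tVi : t^-1%g i = i by rewrite -{1}ti permK.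
apply/setP => x; rewrite -[x](permKV t) mem_imset; last exact: perm_inj.
by rewrite !inE invMg !permM permK tVi.
Qed.

(** Induction on a bound for [#|S :\: S'|]: transposing some [a] in [S] but not in [S'] with some
    [b] in [S'] but not in [S] shrinks the difference, and it fixes [i], which lies in neither
    set. *)
Lemma perm_fixing_trans S S' : i \notin S -> i \notin S' -> #|S| = #|S'| ->
  exists2 t : {perm 'I_n}, t i = i & [set t x | x in S] = S'.
Proof.
move: {2}#|S :\: S'| (leqnn #|S :\: S'|) => N.
elim: N S => [|N IHN] S.
  rewrite leqn0 cards_eq0 finset.setD_eq0 => sSS' _ _ cSS'.
  exists 1%g; first by rewrite perm1.
  under eq_imset do rewrite perm1.
  by rewrite imset_id; apply/eqP; rewrite eqEcard sSS' cSS' /=.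
move=> leN iS iS' cSS'.
have [sSS'|/fintype.subsetPn[a aS aS']] := boolP (S \subset S').
  by apply: IHN => //; move: sSS'; rewrite -finset.setD_eq0 => /eqP->;
     rewrite cards0.
have /fintype.subsetPn[b bS' bS] : ~~ (S' \subset S).
  apply: contra aS' => sS'S.
  by have /eqP-> : S' == S by rewrite eqEcard sS'S cSS' /=.
pose t := tperm a b.
have ti : t i = i.
  by rewrite tpermD //;
    [apply: contraNneq iS => <-|apply: contraNneq iS' => <-].
pose St := [set t x | x in S].
have inSt x : (x \in St) = (t x \in S).
  by rewrite -{1}[x](tpermK a b) mem_imset //; exact: perm_inj.
have [||||u ui uSt] := IHN St.
- rewrite -ltnS; apply: leq_trans leN; apply: proper_card.
  apply/properP; split.
    apply/fintype.subsetP => x; rewrite !inE inSt /t => /andP[xS'].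
    case: tpermP => [_|xb|_ _ ->]; rewrite ?(negPf bS) ?xS' //.
    by rewrite xb bS' in xS'.
  by exists a; rewrite !inE ?aS ?aS' // inSt /t tpermL (negPf bS) andbF.
- by rewrite inSt ti.
- by [].
- by rewrite card_imset //; exact: perm_inj.
exists (t * u)%g; first by rewrite permM ti.
by rewrite -uSt -imset_comp; apply: eq_imset => x; rewrite /= permM.
Qed.

(** Right multiplication by a permutation that fixes [i] and carries [S] to [S'] is a bijection
    between the two fibres. *)
Lemma card_predecessors_eq S S' : i \notin S -> i \notin S' -> #|S| = #|S'| ->
  #|[set s | predecessors i s == S]| = #|[set s | predecessors i s == S']|.
Proof.
move=> iS iS' /(perm_fixing_trans iS iS')[t ti <-].
rewrite -(card_imset _ (mulIg t)); apply: eq_card => s.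
rewrite -[s](mulgKV t) (mem_imset _ _ (mulIg t)).
rewrite !inE (predecessors_mulg _ ti); apply/eqP/eqP => [->//|].
exact: (imset_inj (@perm_inj _ t)).
Qed.

(** Left multiplication by [tperm k k'] exchanges positions [k] and [k'], so the [n] classes that
    partition the symmetric group have equal size. *)
Lemma card_position k : (#|[set s : {perm 'I_n} | s^-1%g i == k]| * n)%N = n`!.
Proof.
have eq_pos k' : #|[set s : {perm 'I_n} | s^-1%g i == k']| =
    #|[set s : {perm 'I_n} | s^-1%g i == k]|.
  rewrite -(card_imset _ (mulgI (tperm k k'))); apply: eq_card => s.
  rewrite -[s](mulKVg (tperm k k')) (mem_imset _ _ (mulgI _)).
  move: (_ * s)%g => {}s.
  by rewrite !inE invMg permM tpermV (canF_eq (tpermK _ _)) tpermL.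
rewrite -card_Sn -[RHS]sum1_card.
rewrite (partition_big (fun s : {perm 'I_n} => s^-1%g i) xpredT) //=.
rewrite (eq_bigr (fun=> #|[set s : {perm 'I_n} | s^-1%g i == k]|)) => [|j _].
  by rewrite sum_nat_const card_ord mulnC.
by rewrite sum1dep_card -(eq_pos j); apply: eq_card => s; rewrite !inE.
Qed.

End RandomPermutation.

(** * The variance of one permutation sample *)

Section PermutationVariance.
Context {R : realType} {n : nat}.
Variables (U : {set 'I_n} -> R) (i : 'I_n).

Lemma sigmaK k : sigma U i k ^+ 2 = uvar (stratum i k) (marginal U i).
Proof. by rewrite sqr_sqrtr // uvar_ge0. Qed.

(** Total expectation over the position of [i]: inside the class of position [k], every set of
    stratum [k] is hit equally often. *)
Lemma umean_predecessors (f : {set 'I_n} -> R) :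
  umean [set: {perm 'I_n}] (fun s => f (predecessors i s)) =
  n%:R^-1 * \sum_(k < n) umean (stratum i k) f.
Proof.
pose N S := #|[set s : {perm 'I_n} | predecessors i s == S]|.
(* A reference set in stratum [k]: the transposition [tperm i k] puts [i] in position [k]. *)
pose S0 k := predecessors i (tperm i k).
have S0P k : S0 k \in stratum i k by rewrite predecessors_stratum tpermV tpermL.
have stratumP (k : 'I_n) S : S \in stratum i k -> (i \notin S) /\ #|S| = k.
  rewrite inE => /andP[/fintype.subsetP sS /eqP ?]; split=> //.
  by apply/negP => /sS; rewrite !inE eqxx.
have NE (k : 'I_n) S : S \in stratum i k -> N S = N (S0 k).
  move=> /stratumP[iS cS]; have [iS0 cS0] := stratumP _ _ (S0P k).
  by apply: card_predecessors_eq => //; rewrite cS.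
(* Stated over any [nmodType] so as to serve both for the [R]-valued sum and, with [g] constantly
   [1] in [nat], for counting the fibres. *)
have sum_fiber (V : nmodType) k (g : {set 'I_n} -> V) :
    \sum_(s : {perm 'I_n} | s^-1%g i == k) g (predecessors i s) =
    \sum_(S in stratum i k) g S *+ N (S0 k).
  rewrite (partition_big (predecessors i) (mem (stratum i k))) /=; last first.
    by move=> s; rewrite predecessors_stratum.
  apply: eq_bigr => S Sk; rewrite -(NE k S Sk) /N -sumr_const.
  apply: eq_big => [s|s /andP[_ /eqP-> //]].
  rewrite inE andb_idl // => /eqP sS.
  by rewrite -predecessors_stratum sS.
have card_fiber (k : 'I_n) : (#|stratum i k| * N (S0 k) * n)%N = n`!.
  rewrite -(card_position i k); congr (_ * _)%N; rewrite -[RHS]sum1dep_card.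
  rewrite -[RHS]/(\sum_(s : {perm 'I_n} | s^-1%g i == k) (1%N : nat))%R.
  by rewrite (sum_fiber nat k (fun=> 1%N)) sumr_const -mulrnA natn mulnC.
have fact_neq0 : n`!%:R != 0 :> R by rewrite pnatr_eq0 -lt0n fact_gt0.
rewrite /umean cardsT card_Sn.
under eq_bigl do rewrite inE.
rewrite (partition_big (fun s : {perm 'I_n} => s^-1%g i) xpredT) //= !mulr_sumr.
apply: eq_bigr => k _; rewrite sum_fiber sumrMnl.
have := fact_neq0; rewrite -(card_fiber k) !natrM !mulf_eq0 !negb_or.
by case/andP=> /andP[? ?] ?; rewrite -[_ *+ _]mulr_natl; field; apply/and3P.
Qed.

(** Within each stratum, deviations from the global mean [c] are on average at least those from the
    stratum mean, by [uvar_le]. *)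
Lemma sum_sigma2_le_uvar :
  n%:R^-1 * \sum_k sigma U i k ^+ 2 <=
  uvar [set: {perm 'I_n}] (fun s => marginal U i (predecessors i s)).
Proof.
rewrite /uvar; set c := umean _ (fun s => marginal _ _ _).
have /= -> := umean_predecessors (fun S => (marginal U i S - c) ^+ 2).
rewrite ler_wpM2l ?invr_ge0 // ler_sum // => k _.
by rewrite sigmaK uvar_le.
Qed.

End PermutationVariance.

(** * Variances of the two estimators and of the uniform allocation *)

Section Estimators.
Context {R : realType} {d : measure_display} {T : measurableType d}.
Variable P : probability T R.
Context {n : nat}.
Variables (U : {set 'I_n} -> R) (i : 'I_n).

Lemma strat_estimator_variance (c : 'I_n -> nat)
    (S : {k : 'I_n & 'I_(c k)} -> T -> {set 'I_n}) :
  (forall k, (0 < c k)%N) -> stratified_draws P i S ->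
  ('V_P[strat_estimator U i S])%E = strat_variance U i (fun k => (c k)%:R).
Proof.
move=> c_gt0 [uS indS].
(* Flattening to one sum over the dependent pairs that index the draws makes
   [variance_sum_independent] applicable. *)
have -> : strat_estimator U i S = fun w =>
    \sum_kj (n%:R^-1 * (c (tag kj))%:R^-1) * marginal U i (S kj w).
  apply/funext => w; rewrite /strat_estimator mulr_sumr.
  under eq_bigr do rewrite mulrA mulr_sumr.
  rewrite (sig_big_dep xpredT (fun k => xpredT)) /=.
  by apply: eq_bigr => -[].
rewrite (variance_sum_independent uS indS
  (fun kj x => n%:R^-1 * (c (tag kj))%:R^-1 * marginal U i x)).
under eq_bigr do rewrite uvarZ.
rewrite -(sig_big_dep xpredT (fun k => xpredT) (fun k (_ : 'I_(c k)) =>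
  (n%:R^-1 * (c k)%:R^-1) ^+ 2 * uvar (stratum i k) (marginal U i))) /=.
rewrite /strat_variance.
have c_neq0 k : (c k)%:R != 0 :> R by rewrite pnatr_eq0 -lt0n.
have n_neq0 : n%:R != 0 :> R by rewrite pnatr_eq0 -lt0n (ordinal_size_gt0 i).
(* Positive sample sizes rule out the infinite case, and the real quotient is already [0] when the
   deviation is [0]. *)
under [in RHS]eq_bigr => k _.
  have -> : var_term (sigma U i k) (c k)%:R = (sigma U i k ^+ 2 / (c k)%:R)%:E.
    rewrite /var_term (negPf (c_neq0 k)).
    by have [->|//] := eqVneq (sigma U i k) 0; rewrite expr0n mul0r.
over.
rewrite sumEFin -EFinM mulr_sumr; congr _%:E; apply: eq_bigr => k _.
rewrite sumr_const card_ord -sigmaK -[_ *+ _]mulr_natl.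
by field; rewrite c_neq0.
Qed.

Lemma perm_estimator_variance (M : nat) (O : 'I_M -> T -> {perm 'I_n}) :
  permutation_draws P O ->
  ('V_P[perm_estimator U i O] =
   (M%:R^-1 * uvar [set: {perm 'I_n}]
     (fun s => marginal U i (predecessors i s)))%:E)%E.
Proof.
move=> [uO indO].
have -> : perm_estimator U i O = fun w =>
    \sum_t M%:R^-1 * marginal U i (predecessors i (O t w)).
  by apply/funext => w; rewrite /perm_estimator mulr_sumr.
rewrite (variance_sum_independent uO indO
  (fun t s => M%:R^-1 * marginal U i (predecessors i s))).
rewrite uvarZ sumr_const card_ord -[_ *+ _]mulr_natl; congr _%:E.
(* For [M = 0] both sides are zero, since the inverse of [0] is [0]. *)
have [->|M0] := eqVneq M%:R (0 : R); first by rewrite invr0 !mul0r.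
by field.
Qed.

Lemma strat_variance_uniform m : 0 < m ->
  strat_variance U i (fun=> m / n%:R) =
  (m^-1 * (n%:R^-1 * \sum_k sigma U i k ^+ 2))%:E.
Proof.
move=> m_gt0; have n_neq0 : n%:R != 0 :> R.
  by rewrite pnatr_eq0 -lt0n (ordinal_size_gt0 i).
have mn_neq0 : m / n%:R != 0 by rewrite mulf_neq0 ?invr_eq0 // gt_eqF.
rewrite /strat_variance.
under eq_bigr => k _.
  have -> : var_term (sigma U i k) (m / n%:R) =
      (sigma U i k ^+ 2 * (n%:R / m))%:E.
    rewrite /var_term (negPf mn_neq0) invf_div.
    by have [->|//] := eqVneq (sigma U i k) 0; rewrite expr0n mul0r.
over.
by rewrite sumEFin -EFinM -mulr_suml; congr _%:E; field; rewrite n_neq0 gt_eqF.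
Qed.

End Estimators.

Theorem theorem4p1 (R : realType) (n : nat) (U : {set 'I_n} -> R) (i : 'I_n)
    (m : R) (U0 : U finset.set0 = 0)
    (sigma_gt0 : 0 < \sum_(j < n) sigma U i j) (m_gt0 : 0 < m) :
  [/\ forall (c : 'I_n -> nat) (d : measure_display) (T : measurableType d)
        (P : probability T R) (S : {k : 'I_n & 'I_(c k)} -> T -> {set 'I_n}),
        (forall k, (0 < c k)%N) -> stratified_draws P i S ->
        ('V_P[strat_estimator U i S])%E
          = strat_variance U i (fun k => (c k)%:R),
      is_allocation m (opt_allocation U i m),
      forall a : 'I_n -> R, is_allocation m a ->
        (strat_variance U i (opt_allocation U i m) <= strat_variance U i a)%E,
      forall a : 'I_n -> R, is_allocation m a ->
        strat_variance U i a = strat_variance U i (opt_allocation U i m) ->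
        forall k, a k = opt_allocation U i m k &
      forall (M : nat) (d : measure_display) (T : measurableType d)
        (P : probability T R) (O : 'I_M -> T -> {perm 'I_n}),
        m = M%:R -> permutation_draws P O ->
        (strat_variance U i (opt_allocation U i m)
          <= 'V_P[perm_estimator U i O])%E].
Proof.
split=> [c d T P S c_gt0 Sdraws|||a am /strat_variance_opt_unique|
         M d T P O mM Odraws].
- exact: strat_estimator_variance.
- exact: opt_allocationP.
- by move=> a; exact: strat_variance_opt_le.
- exact.
rewrite (perm_estimator_variance _ _ Odraws) -mM.
have n_neq0 : n%:R != 0 :> R.
  by rewrite pnatr_eq0 -lt0n (ordinal_size_gt0 i).
(* The share [m / n] need not be an integer; optimality holds over real allocations, so it is still
   a valid competitor. *)
apply: (@le_trans _ _ (strat_variance U i (fun=> m / n%:R))).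
  apply: strat_variance_opt_le => //; split=> [k|].
    by rewrite divr_ge0 // ltW.
  by rewrite sumr_const card_ord -[LHS]mulr_natr divfK.
rewrite strat_variance_uniform // lee_fin ler_wpM2l ?invr_ge0 ?(ltW m_gt0) //.
exact: sum_sigma2_le_uvar.
Qed.
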